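(* Let $(X,r)$ be a solution, and define an equivalence relation on $X$ by $x\approx x'$ if and only if $\iota(x)=\iota(x')$ in $G_{(X,r)}$. Then $r$ induces an injective solution $r'$ on $X/\!\approx$. Moreover, the quotient map $X\twoheadrightarrow X/\!\approx$ induces a group isomorphism $G_{(X,r)}\to G_{(X/\approx,\,r')}$.
   Context: A solution $(X,r)$ is a finite set $X$ with a bijection $r\colon X\times X\to X\times X$, $r(x,y)=(\sigma_x(y),\tau_y(x))$, satisfying the Yang--Baxter equation $r_1r_2r_1=r_2r_1r_2$ on $X^3$ ($r_1=r\times \mathrm{Id}_X$, $r_2=\mathrm{Id}_X\times r$), with all maps $\sigma_x,\tau_x\colon X\to X$ bijective. Its structure group is $G_{(X,r)}=\langle X \mid xy=\sigma_x(y)\tau_y(x),\ x,y\in X\rangle$, and $\iota\colon X\to G_{(X,r)}$, $x\mapsto x$, is the natural map. A solution is injective if $\iota$ is injective. That $r$ induces $r'$ on a quotient means that $r'([x],[y])=([\sigma_x(y)],[\tau_y(x)])$ is well defined. *)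

(* Defs.v *)
From HB Require Import structures.
From mathcomp Require Import all_boot generic_quotient.
From mathcomp Require Import boolp.

Set Implicit Arguments.
Unset Strict Implicit.
Unset Printing Implicit Defensive.

(* A pair (x, b) stands for x if b = false and for the formal inverse of x if
   b = true. *)
Definition word (X : Type) : Type := seq (X * bool).

(* The least congruence on words that identifies the two sides of the given
   equations and cancels the formal inverses. *)
Inductive word_equiv (X : Type) (R : word X -> word X -> Prop) :
  word X -> word X -> Prop :=
| word_refl u : word_equiv R u u
| word_sym u v : word_equiv R u v -> word_equiv R v u
| word_trans u v w : word_equiv R u v -> word_equiv R v w -> word_equiv R u w
| word_cat u u' v v' :
    word_equiv R u u' -> word_equiv R v v' -> word_equiv R (u ++ v) (u' ++ v')
| word_cancel x b : word_equiv R [:: (x, b); (x, ~~ b)] [::]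
| word_rel u v : R u v -> word_equiv R u v.

Definition word_inv (X : Type) (u : word X) : word X :=
  rev [seq (p.1, ~~ p.2) | p <- u].

Section PresentedGroup.
Variables (X : choiceType) (R : word X -> word X -> Prop).

Definition word_rel_bool : rel (seq (X * bool)) :=
  fun u v => `[< word_equiv R u v >].

Lemma word_rel_bool_refl : reflexive word_rel_bool.
Proof. by move=> u; apply/asboolP; exact: word_refl. Qed.

Lemma word_rel_bool_sym : symmetric word_rel_bool.
Proof. by move=> u v; apply/asboolP/asboolP; exact: word_sym. Qed.

Lemma word_rel_bool_trans : transitive word_rel_bool.
Proof.
by move=> v u w /asboolP uv /asboolP vw; apply/asboolP; exact: word_trans vw.
Qed.

Canonical word_equiv_rel :=
  EquivRel word_rel_bool
    word_rel_bool_refl word_rel_bool_sym word_rel_bool_trans.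

Definition presented_group : Type := {eq_quot word_equiv_rel}%qT.

HB.instance Definition _ := Choice.on presented_group.
HB.instance Definition _ := EqQuotient.on presented_group.

Local Open Scope quotient_scope.

Definition pres_class (u : word X) : presented_group := \pi_presented_group u.
Definition pres_one : presented_group := pres_class [::].
Definition pres_mul (a b : presented_group) : presented_group :=
  pres_class (repr a ++ repr b).
Definition pres_inv (a : presented_group) : presented_group :=
  pres_class (word_inv (repr a)).
Definition pres_gen (x : X) : presented_group := pres_class [:: (x, false)].

Lemma pres_classP u v : pres_class u = pres_class v <-> word_equiv R u v.
Proof.
split=> [/eqP|uv]; first by rewrite eqmodE => /asboolP.
by apply/eqP; rewrite eqmodE; apply/asboolP.
Qed.

Lemma pres_class_repr a : pres_class (repr a) = a.
Proof. exact: reprK. Qed.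

Lemma repr_pres_class u : word_equiv R (repr (pres_class u)) u.
Proof. by apply/pres_classP; exact: pres_class_repr. Qed.

Lemma pres_mul_class u v :
  pres_mul (pres_class u) (pres_class v) = pres_class (u ++ v).
Proof. by apply/pres_classP; apply: word_cat; exact: repr_pres_class. Qed.

Lemma word_invK : involutive (@word_inv X).
Proof.
move=> u; rewrite /word_inv map_rev revK -map_comp -[RHS]map_id.
by apply: eq_map => -[x b] /=; rewrite negbK.
Qed.

Lemma word_inv_cat (u v : word X) :
  word_inv (u ++ v) = word_inv v ++ word_inv u.
Proof. by rewrite /word_inv map_cat rev_cat. Qed.

Lemma word_mulV u : word_equiv R (u ++ word_inv u) [::].
Proof.
elim: u => [|[x b] u IH]; first exact: word_refl.
rewrite -cat1s word_inv_cat.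
have -> : ([:: (x, b)] ++ u) ++ word_inv u ++ word_inv [:: (x, b)] =
  [:: (x, b)] ++ (u ++ word_inv u) ++ [:: (x, ~~ b)] by rewrite !catA.
apply: word_trans (word_cancel R x b).
rewrite -[X in word_equiv _ _ X]/([:: (x, b)] ++ [::] ++ [:: (x, ~~ b)]).
by apply: word_cat (word_refl _ _) _; apply: word_cat IH (word_refl _ _).
Qed.

Lemma word_mulVr u : word_equiv R (word_inv u ++ u) [::].
Proof. by have := word_mulV (word_inv u); rewrite word_invK. Qed.

Lemma pres_mulA : associative pres_mul.
Proof.
move=> a b c; rewrite -(pres_class_repr a) -(pres_class_repr b).
rewrite -(pres_class_repr c); move: (repr a) (repr b) (repr c) => u v w.
by rewrite (pres_mul_class v w) (pres_mul_class u v) !pres_mul_class catA.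
Qed.

Lemma pres_mul1 : left_id pres_one pres_mul.
Proof. by move=> a; rewrite -(pres_class_repr a) pres_mul_class. Qed.

Lemma pres_mulr1 : right_id pres_one pres_mul.
Proof. by move=> a; rewrite -(pres_class_repr a) pres_mul_class cats0. Qed.

Lemma pres_mulV : left_inverse pres_one pres_inv pres_mul.
Proof.
move=> a; rewrite /pres_inv -{2}(pres_class_repr a) pres_mul_class.
by apply/pres_classP; exact: word_mulVr.
Qed.

Lemma pres_mulrV : right_inverse pres_one pres_inv pres_mul.
Proof.
move=> a; rewrite /pres_inv -{1}(pres_class_repr a) pres_mul_class.
by apply/pres_classP; exact: word_mulV.
Qed.

HB.instance Definition _ := isGroup.Build presented_group
  pres_mulA pres_mul1 pres_mulr1 pres_mulV pres_mulrV.

End PresentedGroup.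

Arguments pres_gen {X R} x.

(* Universal property of the presentation. *)
Section Lift.
Local Open Scope group_scope.
Variables (X : choiceType) (R : word X -> word X -> Prop).
Variables (H : groupType) (f : X -> H).

Fixpoint word_eval (u : word X) : H :=
  if u is (x, b) :: u' then (if b then (f x)^-1 else f x) * word_eval u' else 1.

Lemma word_eval_cat u v : word_eval (u ++ v) = word_eval u * word_eval v.
Proof. by elim: u => [|[x b] u IH] /=; rewrite ?mul1g // IH mulgA. Qed.

Hypothesis Rf : forall u v, R u v -> word_eval u = word_eval v.

Lemma word_eval_equiv u v : word_equiv R u v -> word_eval u = word_eval v.
Proof.
elim=> {u v} [//|u v _ ->//|u v w _ -> _ ->//|u u' v v' _ Eu _ Ev|x b|u v].
- by rewrite !word_eval_cat Eu Ev.
- by case: b => /=; rewrite mulg1 ?mulVg ?mulgV.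
- exact: Rf.
Qed.

Definition pres_lift (a : presented_group R) : H := word_eval (repr a).

Lemma pres_lift_class u : pres_lift (pres_class R u) = word_eval u.
Proof. by apply: word_eval_equiv; exact: repr_pres_class. Qed.

Lemma pres_lift_gen x : pres_lift (pres_gen x) = f x.
Proof. by rewrite pres_lift_class /= mulg1. Qed.

Lemma pres_lift_mul : {morph pres_lift : a b / a * b}.
Proof. by move=> a b; rewrite [LHS]pres_lift_class word_eval_cat. Qed.

End Lift.

Section Solutions.
Variables (X : finType) (r : X * X -> X * X).

Definition sigma (x y : X) : X := (r (x, y)).1.
Definition tau (y x : X) : X := (r (x, y)).2.

Definition braid1 (t : X * X * X) : X * X * X :=
  let: (x, y, z) := t in (r (x, y), z).
Definition braid2 (t : X * X * X) : X * X * X :=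
  let: (x, y, z) := t in let: (y', z') := r (y, z) in (x, y', z').

Definition is_solution : Prop :=
  [/\ bijective r,
      braid1 \o braid2 \o braid1 =1 braid2 \o braid1 \o braid2,
      forall x, bijective (sigma x)
    & forall y, bijective (tau y)].

Definition structure_relation (u v : word X) : Prop :=
  exists x y, u = [:: (x, false); (y, false)] /\
              v = [:: (sigma x y, false); (tau y x, false)].

Definition structure_group : Type := presented_group structure_relation.

HB.instance Definition _ := Group.on structure_group.

Definition iota_gen (x : X) : structure_group := pres_gen x.

Definition is_injective_solution : Prop := is_solution /\ injective iota_gen.

Definition iota_rel : rel X := fun x y => iota_gen x == iota_gen y.

Lemma iota_rel_refl : reflexive iota_rel.
Proof. by move=> x; rewrite /iota_rel. Qed.

Lemma iota_rel_sym : symmetric iota_rel.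
Proof. by move=> x y; rewrite /iota_rel eq_sym. Qed.

Lemma iota_rel_trans : transitive iota_rel.
Proof. by move=> y x z /eqP xy /eqP yz; rewrite /iota_rel xy yz. Qed.

Canonical iota_equiv_rel :=
  EquivRel iota_rel iota_rel_refl iota_rel_sym iota_rel_trans.

Definition iota_quotient : Type := {eq_quot iota_equiv_rel}%qT.

HB.instance Definition _ := Choice.on iota_quotient.
HB.instance Definition _ := EqQuotient.on iota_quotient.
Lemma iota_quotient_reprK :
  cancel (@repr X iota_quotient) (\pi_iota_quotient : X -> iota_quotient)%qT.
Proof. exact: reprK. Qed.

HB.instance Definition _ : isCountable iota_quotient :=
  CanIsCountable iota_quotient_reprK.
HB.instance Definition _ : isFinite iota_quotient :=
  CanIsFinite iota_quotient_reprK.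

Definition iota_class (x : X) : iota_quotient := (\pi_iota_quotient x)%qT.

End Solutions.

Arguments structure_group {X} r.
Arguments iota_quotient {X} r.

(* Main.v *)
From HB Require Import structures.
Require Import Defs.
From mathcomp Require Import all_boot.
From mathcomp Require Import perm generic_quotient.

(** The Yang--Baxter equation says that the [sigma r x] and the [tau r y] obey
    the defining relations of the structure group G, so G acts on X on the left
    through sigma and on the right through tau.  Hence [sigma r x] depends only
    on iota x, and [tau r y] only on iota y ([sigma_iota], [tau_iota]).  This
    settles one argument of each map.  For the other one, cancel in
    iota x * iota y = iota (sigma x y) * iota (tau y x): once sigma x is known
    to depend only on iota x, the factor iota (tau y x) is determined by iota x
    for fixed y, and symmetrically for iota (sigma x y) ([iota_tau_congr],
    [iota_sigma_congr]).  So r descends to a map r' on classes.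

    The Yang--Baxter equation passes to X/~.  Bijectivity does too, but
    by a finiteness argument: a map induced by a surjective map is surjective,
    hence bijective on a finite set ([quotient_bijective]).

    Finally [x] |-> iota x is well defined by the choice of the equivalence and
    respects the relations of G' := G_(X/~, r'), so it gives a morphism G' -> G.
    It is inverse to the morphism G -> G' induced by the quotient map because
    both composites fix the generators.  Injectivity of r' follows: composing
    iota' with G' -> G sends [x] to iota x, and iota x determines [x]. *)

Set Implicit Arguments.
Unset Strict Implicit.
Unset Printing Implicit Defensive.

Local Open Scope group_scope.

(** Only surjectivity goes down to a quotient for free; finiteness of the
    quotient upgrades it to bijectivity. *)
Lemma quotient_bijective (A : Type) (B : finType) (q : A -> B) (s : B -> A)
    (f : A -> A) (f' : B -> B) :
  cancel s q -> (forall a, f' (q a) = q (f a)) -> bijective f -> bijective f'.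
Proof.
move=> sK f'q [g _ gK].
have gsK : cancel (q \o g \o s) f' by move=> b; rewrite /= f'q gK sK.
exact (bij_can_bij (injF_bij (can_inj gsK)) gsK).
Qed.

Section StructureGroup.
Variables (X : finType) (r : X * X -> X * X).

Lemma braid1E x y z : braid1 r (x, y, z) = (sigma r x y, tau r y x, z).
Proof. by rewrite /= -surjective_pairing. Qed.

Lemma braid2E x y z : braid2 r (x, y, z) = (x, sigma r y z, tau r z y).
Proof. by rewrite /sigma /tau /=; case: (r (y, z)). Qed.

Lemma iota_genM x y :
  iota_gen r x * iota_gen r y =
  iota_gen r (sigma r x y) * iota_gen r (tau r y x).
Proof.
rewrite /iota_gen /pres_gen /mul /= !pres_mul_class.
by apply/pres_classP/word_rel; exists x, y.
Qed.

Section UniversalProperty.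
Variables (H : groupType) (f : X -> H).
Hypothesis fM : forall x y, f x * f y = f (sigma r x y) * f (tau r y x).

Lemma structure_group_lift :
  exists F : {multiplicative structure_group r -> H},
    forall x, F (iota_gen r x) = f x.
Proof.
have fR u v : structure_relation r u v -> word_eval f u = word_eval f v.
  by move=> [x [y [-> ->]]]; rewrite /= !mulg1 fM.
pose F : structure_group r -> H := @pres_lift X (structure_relation r) H f.
have FM : {morph F : a b / a * b} by exact: (pres_lift_mul fR).
exists (HB.pack_for {multiplicative structure_group r -> H} F
  (isMultiplicative.Build (structure_group r) H F FM)).
exact: (pres_lift_gen fR).
Qed.

(** How equality in the structure group is exploited: every assignment that
    obeys the relations is blind to the difference between [x] and [x']. *)
Lemma iota_gen_eq_image x x' : iota_gen r x = iota_gen r x' -> f x = f x'.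
Proof. by have [F FE] := structure_group_lift => xx'; rewrite -!FE xx'. Qed.

End UniversalProperty.

Lemma structure_morphism_eval (H : groupType)
    (f : {multiplicative structure_group r -> H}) u :
  f (pres_class _ u) = word_eval (f \o iota_gen r) u.
Proof.
have f1 : f 1 = 1 by apply: (mulgI (f 1)); rewrite -gmulfM !mulg1.
have fV a : f a^-1 = (f a)^-1.
  by apply: (mulgI (f a)); rewrite -gmulfM !mulgV.
have genV x :
    pres_class (structure_relation r) [:: (x, true)] = (iota_gen r x)^-1.
  apply: (mulgI (iota_gen r x)); rewrite mulgV [LHS]pres_mul_class.
  by apply/pres_classP; exact: (word_cancel _ x false).
elim: u => [|[x b] u IH]; first exact: f1.
rewrite -cat1s -pres_mul_class [LHS]gmulfM IH /=; congr (_ * _).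
by case: b; rewrite ?genV ?fV.
Qed.

(** The generators generate: what a morphism does to them fixes its value on
    every word. *)
Lemma structure_morphism_ext (H : groupType)
    (f g : {multiplicative structure_group r -> H}) :
  f \o iota_gen r =1 g \o iota_gen r -> f =1 g.
Proof.
move=> fg a; rewrite -(pres_class_repr a) !structure_morphism_eval.
by elim: (repr a) => [//|[x b] u /= ->]; rewrite -[f _]/((f \o _) x) fg.
Qed.

Hypothesis sol_r : is_solution r.

Lemma sigma_inj x : injective (sigma r x).
Proof. by case: sol_r => _ _ /(_ x)/bij_inj. Qed.

Lemma tau_inj y : injective (tau r y).
Proof. by case: sol_r => _ _ _ /(_ y)/bij_inj. Qed.

(** First component of the Yang--Baxter equation: x |-> [sigma r x] respects the
    relations of the structure group, as a left action. *)
Lemma sigma_action x y z :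
  sigma r x (sigma r y z) = sigma r (sigma r x y) (sigma r (tau r y x) z).
Proof.
have [_ /(_ (x, y, z)) + _ _] := sol_r.
by rewrite /comp !(braid1E, braid2E) => -[].
Qed.

(** Third component of the Yang--Baxter equation: y |-> [tau r y] respects the
    relations of the structure group, as a right action. *)
Lemma tau_action x y z :
  tau r z (tau r y x) = tau r (tau r z y) (tau r (sigma r y z) x).
Proof.
have [_ /(_ (x, y, z)) + _ _] := sol_r.
by rewrite /comp !(braid1E, braid2E) => -[].
Qed.

Lemma sigma_iota x x' : iota_gen r x = iota_gen r x' -> sigma r x =1 sigma r x'.
Proof.
(* Permutations compose from left to right, whereas sigma is a left action:
   inverting turns it into a morphism to the group of permutations. *)
pose f z := (perm (@sigma_inj z))^-1.
have fM z t : f z * f t = f (sigma r z t) * f (tau r t z).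
  rewrite -!invgM; congr (_^-1); apply/permP => w.
  by rewrite !permM !permE sigma_action.
move=> /(iota_gen_eq_image fM)/invg_inj/permP xx' y.
by have := xx' y; rewrite !permE.
Qed.

Lemma tau_iota y y' : iota_gen r y = iota_gen r y' -> tau r y =1 tau r y'.
Proof.
pose f z := perm (@tau_inj z).
have fM z t : f z * f t = f (sigma r z t) * f (tau r t z).
  by apply/permP => w; rewrite !permM !permE tau_action.
move=> /(iota_gen_eq_image fM)/permP yy' x.
by have := yy' x; rewrite !permE.
Qed.

(** After replacing [x] by [x'], both [sigma r x' y] and [sigma r x' y'] are the
    left factors of the same product, with right factors [tau r y x'] and
    [tau r y' x'] that coincide because tau depends only on iota. *)
Lemma iota_sigma_congr x x' y y' :
  iota_gen r x = iota_gen r x' -> iota_gen r y = iota_gen r y' ->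
  iota_gen r (sigma r x y) = iota_gen r (sigma r x' y').
Proof.
move=> xx' yy'; rewrite (sigma_iota xx').
apply: (mulIg (iota_gen r (tau r y x'))).
by rewrite -iota_genM [in RHS](tau_iota yy') -iota_genM yy'.
Qed.

Lemma iota_tau_congr x x' y y' :
  iota_gen r x = iota_gen r x' -> iota_gen r y = iota_gen r y' ->
  iota_gen r (tau r y x) = iota_gen r (tau r y' x').
Proof.
move=> xx' yy'; rewrite (tau_iota yy').
apply: (mulgI (iota_gen r (sigma r x y'))).
by rewrite -iota_genM [in RHS](sigma_iota xx') -iota_genM xx'.
Qed.

Lemma iota_classP x y :
  iota_class r x = iota_class r y <-> iota_gen r x = iota_gen r y.
Proof.
split=> [/eqP|xy]; first by rewrite eqmodE => /eqP.
by apply/eqP; rewrite eqmodE; apply/eqP.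
Qed.

Lemma iota_class_repr (c : iota_quotient r) : iota_class r (repr c) = c.
Proof. exact: reprK. Qed.

Lemma iota_gen_repr x : iota_gen r (repr (iota_class r x)) = iota_gen r x.
Proof. by apply/iota_classP; exact: iota_class_repr. Qed.

(** The map r' of the statement, computed on canonical representatives so that
    it exists before its independence of them is known. *)
Definition quotient_solution (p : iota_quotient r * iota_quotient r) :
    iota_quotient r * iota_quotient r :=
  (iota_class r (sigma r (repr p.1) (repr p.2)),
   iota_class r (tau r (repr p.2) (repr p.1))).

Local Notation r' := quotient_solution.

Lemma quotient_solutionE x y :
  r' (iota_class r x, iota_class r y) =
    (iota_class r (sigma r x y), iota_class r (tau r y x)).
Proof.
by congr (_, _); apply/iota_classP;
  [apply: iota_sigma_congr | apply: iota_tau_congr]; exact: iota_gen_repr.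
Qed.

Lemma quotient_sigmaE x y :
  sigma r' (iota_class r x) (iota_class r y) = iota_class r (sigma r x y).
Proof. by rewrite {1}/sigma quotient_solutionE. Qed.

Lemma quotient_tauE x y :
  tau r' (iota_class r y) (iota_class r x) = iota_class r (tau r y x).
Proof. by rewrite {1}/tau quotient_solutionE. Qed.

Lemma quotient_is_solution : is_solution r'.
Proof.
have [bij_r ybe_r bij_sigma bij_tau] := sol_r.
have cK : cancel (@repr X (iota_quotient r)) (iota_class r) := iota_class_repr.
split.
- pose q (p : X * X) := (iota_class r p.1, iota_class r p.2).
  pose s (p : iota_quotient r * iota_quotient r) := (repr p.1, repr p.2).
  have sK : cancel s q by case=> a b; rewrite /q /s /= !cK.
  by apply: (quotient_bijective sK) bij_r => -[x y]; exact: quotient_solutionE.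
- pose q (t : X * X * X) :=
    (iota_class r t.1.1, iota_class r t.1.2, iota_class r t.2).
  have q1 t : braid1 r' (q t) = q (braid1 r t).
    case: t => [[x y] z]; rewrite !braid1E.
    by congr (_, _, _); [exact: quotient_sigmaE | exact: quotient_tauE].
  have q2 t : braid2 r' (q t) = q (braid2 r t).
    case: t => [[x y] z]; rewrite !braid2E.
    by congr (_, _, _); [exact: quotient_sigmaE | exact: quotient_tauE].
  move=> [[a b] c]; rewrite -(cK a) -(cK b) -(cK c) /comp.
  rewrite -[(_, _, _)]/(q (repr a, repr b, repr c)) !(q1, q2).
  by congr q; exact: ybe_r.
- move=> a; rewrite -(cK a).
  apply: (quotient_bijective cK) (bij_sigma (repr a)) => y.
  exact: quotient_sigmaE.
- move=> b; rewrite -(cK b).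
  apply: (quotient_bijective cK) (bij_tau (repr b)) => x.
  exact: quotient_tauE.
Qed.

End StructureGroup.

Theorem proposition6p6 (X : finType) (r : X * X -> X * X) :
  is_solution r ->
  exists2 r' : iota_quotient r * iota_quotient r ->
               iota_quotient r * iota_quotient r,
    (forall x y : X, r' (iota_class r x, iota_class r y) =
       (iota_class r (sigma r x y), iota_class r (tau r y x)))
  & is_injective_solution r' /\
    exists2 f : {multiplicative structure_group r -> structure_group r'},
      (forall x : X, f (iota_gen r x) = iota_gen r' (iota_class r x))
    & bijective f.
Proof.
move=> sol_r; pose r' := @quotient_solution X r.
exists r'; first exact: quotient_solutionE.
have sol_r' : is_solution r' := quotient_is_solution sol_r.
have [|f fE] := @structure_group_lift X r (structure_group r')
    (fun x => iota_gen r' (iota_class r x)).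
  by move=> x y; rewrite iota_genM (quotient_sigmaE sol_r) (quotient_tauE sol_r).
have [|g gE] := @structure_group_lift (iota_quotient r) r' (structure_group r)
    (fun c => iota_gen r (repr c)).
  move=> a b; rewrite -(iota_class_repr a) -(iota_class_repr b).
  rewrite (quotient_sigmaE sol_r) (quotient_tauE sol_r) !iota_gen_repr.
  exact: iota_genM.
have gE' x : g (iota_gen r' (iota_class r x)) = iota_gen r x.
  by rewrite gE iota_gen_repr.
split.
  split=> // a b; rewrite -(iota_class_repr a) -(iota_class_repr b) => ab.
  by apply/iota_classP; rewrite -!gE' ab.
exists f => //; exists g.
  apply: (@structure_morphism_ext _ _ _ (g \o f) idfun) => x /=.
  by rewrite fE gE'.
apply: (@structure_morphism_ext _ _ _ (f \o g) idfun) => c /=.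
by rewrite -(iota_class_repr c) gE' fE.
Qed.
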